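(* Let $K$ be a field, let $\Delta$ be a unimodular simplicial complex on $[n]$, and let $\Delta^*$ be the simplicial complex whose facets are the minimal vertex covers of $\Delta$. Then the vertex cover algebras $A(\Delta)$ and $A(\Delta^* )$ are standard graded algebras.
   Context: $\mathbb{N}=\{0,1,2,\ldots\}$ and $[n]=\{1,\ldots,n\}$. A simplicial complex on $[n]$ is a collection of subsets of $[n]$ (faces) closed under taking subsets; its maximal faces are its facets, and $\mathcal{F}(\Delta)$ is the set of facets. Complexes have at least one facet and their facets are nonempty. A vertex cover of $\Delta$ is a subset $C\subseteq[n]$ with $C\cap F\ne\emptyset$ for all $F\in\mathcal{F}(\Delta)$; minimal means minimal under inclusion. The incidence matrix of $\Delta$ with facets $F_1,\ldots,F_m$ is the $n\times m$ matrix $(e_{ij})$ with $e_{ij}=1$ if $i\in F_j$ and $e_{ij}=0$ otherwise. $\Delta$ is unimodular if every square submatrix of its incidence matrix has determinant $0$, $1$ or $-1$. For $k\ge 0$, a vector $\mathbf{c}=(c_1,\ldots,c_n)\in\mathbb{N}^n$ is a $k$-cover of a simplicial complex $\Sigma$ on $[n]$ if $\sum_{i\in F}c_i\ge k$ for all $F\in\mathcal{F}(\Sigma)$. Let $S=K[x_1,\ldots,x_n]$, let $t$ be a new variable, and let $A_k(\Sigma)$ be the $K$-span of all monomials $x_1^{c_1}\cdots x_n^{c_n}t^k$ with $(c_1,\ldots,c_n)$ a $k$-cover of $\Sigma$. The vertex cover algebra is the graded $S$-algebra $A(\Sigma)=\bigoplus_{k\ge 0}A_k(\Sigma)\subseteq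 S[t]$ (so $A_0(\Sigma)=S$). It is called standard graded if it is generated over $S$ by $A_1(\Sigma)$. *)

(* Defs.v *)
From mathcomp Require Import all_boot all_order all_algebra.
From mathcomp Require Import mpoly.

Set Implicit Arguments.
Unset Strict Implicit.
Unset Printing Implicit Defensive.

Import GRing.Theory.
Local Open Scope ring_scope.

Definition facets_of n (D : {set {set 'I_n}}) : {set {set 'I_n}} :=
  [set F | maxset (fun G => G \in D) F].

(* The vertex set {1, ..., n} is 'I_n; not every vertex has to be a face. *)
Record simplicial_complex (n : nat) := SimplicialComplex {
  faces : {set {set 'I_n}};
  faces_down : forall F G : {set 'I_n},
    F \in faces -> G \subset F -> G \in faces;
  has_facet : facets_of faces != set0;
  facet_neq0 : forall F : {set 'I_n}, F \in facets_of faces -> F != set0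
}.

Definition facets n (D : simplicial_complex n) : {set {set 'I_n}} :=
  facets_of (faces D).

Definition vertex_cover n (D : simplicial_complex n) (C : {set 'I_n}) : bool :=
  [forall F in facets D, C :&: F != set0].

Definition minimal_vertex_cover n (D : simplicial_complex n)
    (C : {set 'I_n}) : bool :=
  minset (vertex_cover D) C.

Definition incidence_matrix n (D : simplicial_complex n) :
    'M[int]_(n, #|facets D|) :=
  \matrix_(i < n, j < #|facets D|) (i \in (enum_val j : {set 'I_n}))%:R.

Definition unimodular n (D : simplicial_complex n) : Prop :=
  forall (r : nat) (f : 'I_r -> 'I_n) (g : 'I_r -> 'I_#|facets D|),
    {homo f : i j / (i < j)%N} -> {homo g : i j / (i < j)%N} ->
    \det (mxsub f g (incidence_matrix D)) \in [:: 0; 1; -1].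

Section DualComplex.
Variables (n : nat) (D : simplicial_complex n).

Definition dual_faces : {set {set 'I_n}} :=
  [set G : {set 'I_n} | [exists C : {set 'I_n}, minimal_vertex_cover D C && (G \subset C)]].

Lemma dual_facetsE :
  facets_of dual_faces = [set C | minimal_vertex_cover D C].
Proof.
have min_face C : minimal_vertex_cover D C -> C \in dual_faces.
  by move=> mC; rewrite inE; apply/existsP; exists C; rewrite mC subxx.
apply/setP=> C; rewrite !inE; apply/maxsetP/idP => [[]|mC].
  rewrite inE => /existsP[B /andP[mB sCB]] /(_ B (min_face B mB) sCB) <- //.
split=> [|B]; first exact: min_face.
rewrite inE => /existsP[B' /andP[mB' sBB']] sCB.
have eCB' : C = B'.
  have [_ minB'] := minsetP mB'; apply: minB'.
    by have [] := minsetP mC.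
  exact: subset_trans sBB'.
by apply/eqP; rewrite eqEsubset sCB eCB' sBB'.
Qed.

Lemma dual_faces_down (F G : {set 'I_n}) :
  F \in dual_faces -> G \subset F -> G \in dual_faces.
Proof.
rewrite !inE => /existsP[C /andP[mC sFC]] sGF.
by apply/existsP; exists C; rewrite mC (subset_trans sGF).
Qed.

Lemma dual_has_facet : facets_of dual_faces != set0.
Proof.
have covT : vertex_cover D setT.
  by apply/forall_inP=> F /facet_neq0; rewrite setTI.
have [C mC _] := minset_exists covT.
by apply/set0Pn; exists C; rewrite dual_facetsE inE.
Qed.

Lemma dual_facet_neq0 (F : {set 'I_n}) :
  F \in facets_of dual_faces -> F != set0.
Proof.
rewrite dual_facetsE inE => /minsetP[/forall_inP covF _].
have /set0Pn[G /covF] := has_facet D.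
by apply: contraNneq => ->; rewrite set0I.
Qed.

Definition dual_complex : simplicial_complex n :=
  SimplicialComplex dual_faces_down dual_has_facet dual_facet_neq0.

Lemma facets_dual :
  facets dual_complex = [set C | minimal_vertex_cover D C].
Proof. exact: dual_facetsE. Qed.

End DualComplex.

Definition kcover n (D : simplicial_complex n) (k : nat)
    (c : 'X_{1..n}) : Prop :=
  forall F : {set 'I_n}, F \in facets D -> (k <= \sum_(i in F) c i)%N.

(* S[t] is {poly {mpoly K[n]}}.  The sequence s lists the terms
   (coefficient, exponent vector) of a K-linear combination. *)
Definition cover_component (K : fieldType) n (D : simplicial_complex n)
    (k : nat) (f : {poly {mpoly K[n]}}) : Prop :=
  exists2 s : seq (K * 'X_{1..n}),
    (forall p, p \in s -> kcover D k p.2)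
    & f = \sum_(p <- s) (p.1 *: 'X_[p.2]) *: 'X^k.

Definition vertex_cover_algebra (K : fieldType) n (D : simplicial_complex n)
    (f : {poly {mpoly K[n]}}) : Prop :=
  exists (N : nat) (g : nat -> {poly {mpoly K[n]}}),
    (forall k, cover_component D k (g k)) /\ f = \sum_(k < N) g k.

Inductive generated_subalgebra (R : comNzRingType) (A : algType R)
    (G : A -> Prop) : A -> Prop :=
| gen_scalar (a : R) : generated_subalgebra G a%:A
| gen_mem (x : A) : G x -> generated_subalgebra G x
| gen_add (x y : A) : generated_subalgebra G x -> generated_subalgebra G y ->
    generated_subalgebra G (x + y)
| gen_mul (x y : A) : generated_subalgebra G x -> generated_subalgebra G y ->
    generated_subalgebra G (x * y).

Definition standard_graded (K : fieldType) n (D : simplicial_complex n) : Prop :=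
  forall f : {poly {mpoly K[n]}},
    vertex_cover_algebra D f <->
    generated_subalgebra (@cover_component K n D 1) f.

(* Main.v *)
Require Import Defs.
From mathcomp Require Import all_boot all_order all_fingroup all_algebra.
From mathcomp Require Import mpoly.
From mathcomp Require Import ring lra zify.

Set Implicit Arguments.
Unset Strict Implicit.
Unset Printing Implicit Defensive.

Import Order.TTheory GRing.Theory Num.Theory.
Local Open Scope ring_scope.

(** A vertex cover algebra is standard graded as soon as every (k+1)-cover is
    the sum of a 1-cover and a k-cover, because a monomial of degree k+1 in t
    then factors through the component of degree 1 ([splits_covers_standard]).
    So two decomposition statements about integer vectors are at stake, and
    both follow from one rounding principle ([tu_rounding]): for a totally
    unimodular matrix A and a rational vector x there is an integer vector y
    such that y and A y respect every integer bound that the entries of x and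
    A x satisfy, and such that a prescribed linear functional does not
    decrease.  To obtain y, move x along a direction that keeps the integer
    entries of (x, A x) constant until one more entry becomes an integer; when
    no such direction exists, the fractional entries of x solve an integer
    system with determinant 1 or -1, so there are none.

    For Delta, round x = c / (k+1), where c is a (k+1)-cover and A is the
    transposed incidence matrix.  Each facet has weight at least 1 in x and at
    least k in c - x, and these integer bounds pass to y and c - y.

    For the dual complex the decomposition is a packing property: if every
    vertex cover of Delta has c-weight at least k+1, there are k+1 facets,
    with repetitions, whose indicator vectors add up to at most c.  One of
    these facets is the 1-cover to split off, and the k others bound the rest
    from below.  The packing is first built with rational multiplicities,
    greedily ([fractional_packing]): a facet F is found that lies in the
    support of the weight and meets every vertex cover of least weight in
    exactly one point ([tight_facet]), and the largest possible multiple of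
    its indicator is subtracted.  That F exists follows from the decomposition
    for Delta itself: otherwise the sum of the N covers of least weight could
    be lowered to an N-cover that is too light to be a sum of N 1-covers.  The
    rational packing is then rounded, with A the incidence matrix and the
    total multiplicity as the functional. *)

(** * Total unimodularity *)

(** The step of a ratio test: starting from the slacks [b], which shrink at the
    rates [a], go as far as no slack turns negative; then some slack that was
    positive has vanished, which makes the iterations below terminate. *)
Lemma max_step (R : realFieldType) (I : finType) (a b : I -> R) :
    (forall i, 0 <= b i) -> (forall i, 0 < a i -> 0 < b i) ->
    (exists i, 0 < a i) ->
  exists2 e : R, 0 < e &
    (forall i, a i * e <= b i) /\ (exists2 i, 0 < b i & a i * e = b i).
Proof.
move=> b_ge0 b_gt0 [i0 ai0].
case: (@arg_minP _ _ _ i0 (fun i => 0 < a i) (fun i => b i / a i) ai0) => i ai min_i.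
exists (b i / a i); first by rewrite divr_gt0 // b_gt0.
split=> [j|]; last by exists i; [exact: b_gt0 | rewrite mulrC divfK // gt_eqF].
have [aj|aj] := ltP 0 (a j); first by rewrite mulrC -ler_pdivlMr // min_i.
apply: le_trans (b_ge0 j); rewrite mulr_le0_ge0 //.
by rewrite divr_ge0 ?(ltW ai).
Qed.

(** Reduces arbitrary minors to minors with rows and columns in increasing
    order, up to permutations of both. *)
Lemma increasing_perm r n (f : 'I_r -> 'I_n) :
    injective f ->
  exists (h : 'I_r -> 'I_n) (s : {perm 'I_r}),
    {homo h : i j / (i < j)%N} /\ f =1 h \o s.
Proof.
move=> f_inj; pose X := [set f i | i : 'I_r].
have cX : #|X| = r by rewrite card_imset // card_ord.
pose h (i : 'I_r) : 'I_n := enum_val (cast_ord (esym cX) i).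
have h_incr : {homo h : i j / (i < j)%N}.
  move=> i j lt_ij; rewrite /h /enum_val.
  have sortedX : sorted ltn [seq val i | i <- enum X].
    rewrite sorted_map /enum_mem -enumT.
    apply: sorted_filter; first by move=> x y z /=; apply: ltn_trans.
    by rewrite -sorted_map val_enum_ord iota_ltn_sorted.
  have szX : size (enum X) = r by rewrite -cardE.
  rewrite -!(nth_map _ 0%N val) ?szX //=.
  by apply: (sorted_ltn_nth ltn_trans) => //; rewrite inE size_map szX /=.
have hX i : f i \in X by apply: imset_f.
pose s0 i : 'I_r := cast_ord cX (enum_rank_in (hX i) (f i)).
have hs0 i : h (s0 i) = f i by rewrite /h /s0 cast_ordK enum_rankK_in.
have s0_inj : injective s0.
  by move=> i j /(congr1 h); rewrite !hs0 => /f_inj.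
by exists h, (perm s0_inj); split=> // i; rewrite /= permE hs0.
Qed.

(** Rows and columns are selected in any order, so that the selections produced
    by rank computations can be used as they come. *)
Definition totally_unimodular p q (A : 'M[int]_(p, q)) : Prop :=
  forall r (f : 'I_r -> 'I_p) (g : 'I_r -> 'I_q),
    injective f -> injective g -> \det (mxsub f g A) \in [:: 0; 1; -1].

Lemma totally_unimodular_tr p q (A : 'M[int]_(p, q)) :
  totally_unimodular A -> totally_unimodular A^T.
Proof.
by move=> tuA r f g f_inj g_inj; rewrite -det_tr -trmx_mxsub trmxK; apply: tuA.
Qed.

Lemma unimodular_total n (D : simplicial_complex n) :
  unimodular D -> totally_unimodular (incidence_matrix D).
Proof.
move=> uD r f g /increasing_perm[f' [s [f'_incr ff']]].
move=> /increasing_perm[g' [t [g'_incr gg']]].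
have -> : mxsub f g (incidence_matrix D) =
    perm_mx s *m mxsub f' g' (incidence_matrix D) *m perm_mx t^-1.
  rewrite -row_permE -col_permE; apply/matrixP=> i j.
  by rewrite !mxE ff' gg'.
rewrite !det_mulmx !det_perm.
have := uD r f' g' f'_incr g'_incr.
rewrite !inE => /or3P[] /eqP->; rewrite ?mulr0 ?mul0r ?eqxx //.
  all: by case: (odd_perm s); case: (odd_perm _).
Qed.

(** * Rounding with a totally unimodular matrix *)

(** Let B be the submatrix of A on the rows where A x is an integer and the
    columns where x is not.  If B had full column rank, a square invertible
    part of it would have an inverse over the integers; as B maps the
    fractional part of x to an integer vector, that part would be an integer
    vector too.  So B kills a nonzero vector, which is extended by zero. *)
Lemma fractional_direction p q (A : 'M[int]_(p, q)) (x : 'cV[rat]_q)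
    (AQ := map_mx intr A : 'M[rat]_(p, q)) :
    totally_unimodular A -> (exists i, x i 0 \isn't a Num.int) ->
  exists2 z : 'cV[rat]_q, z != 0 &
    (forall i, x i 0 \is a Num.int -> z i 0 = 0) /\
    (forall j, (AQ *m x) j 0 \is a Num.int -> (AQ *m z) j 0 = 0).
Proof.
move=> tuA [i0 x_i0].
pose I := [set i | x i 0 \isn't a Num.int].
pose T := [set j | (AQ *m x) j 0 \is a Num.int].
pose h : 'I_#|I| -> 'I_q := enum_val; pose k : 'I_#|T| -> 'I_p := enum_val.
have h_inj : injective h by apply: enum_val_inj.
have k_inj : injective k by apply: enum_val_inj.
pose B : 'M[rat]_(#|T|, #|I|) := mxsub k h AQ.
have [fullB|] := boolP (row_full B).
  (* [C], a square submatrix of [A] of full rank, is invertible over int;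
     [u] collects the fractional entries of [x]. *)
  pose f := k \o fullrankfun fullB.
  have f_inj : injective f by apply: inj_comp k_inj (fullrankfun_inj (rkA := _)).
  pose C := mxsub f h A.
  have CE : map_mx intr C = rowsub (fullrankfun fullB) B.
    by apply/matrixP=> i j; rewrite !mxE.
  have Cunit : C \in unitmx.
    have := fullrowsub_unit fullB; rewrite -CE !unitmxE det_map_mx unitfE intr_eq0.
    have := tuA _ _ _ f_inj h_inj; rewrite -/C !inE.
    by case/or3P=> /eqP->.
  pose u : 'cV[rat]_#|I| := \col_l x (h l) 0.
  have Cu_int i : (map_mx intr C *m u) i 0 \is a Num.int.
    have fiT : (AQ *m x) (f i) 0 \is a Num.int.
      by have := enum_valP (fullrankfun fullB i); rewrite inE.
    rewrite !mxE (bigID (mem I)) /= in fiT.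
    have -> : (map_mx intr C *m u) i 0 = \sum_(l in I) AQ (f i) l * x l 0.
      by rewrite big_enum_val mxE; apply: eq_bigr => l _; rewrite !mxE.
    rewrite -(rpredDr _ (_ : \sum_(l | l \notin I) AQ (f i) l * x l 0 \is a Num.int)) //.
    apply: rpred_sum => l; rewrite inE negbK => xl.
    by rewrite rpredM // mxE intr_int.
  have uE : u = map_mx intr (invmx C) *m (map_mx intr C *m u).
    by rewrite mulmxA -map_mxM mulVmx // map_mx1 mul1mx.
  have i0I : i0 \in I by rewrite inE.
  case/negP: x_i0; have <- : u (enum_rank_in i0I i0) 0 = x i0 0.
    by rewrite mxE /h enum_rankK_in.
  rewrite uE mxE rpred_sum // => l _; rewrite rpredM //.
  by rewrite mxE intr_int.
rewrite -col_leq_rank -ltnNge => rankB.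
have : kermx B^T != 0.
  by rewrite kermx_eq0 /row_free mxrank_tr neq_ltn rankB.
case/rowV0Pn=> v /sub_kermxP vB v_neq0.
(* [v] extended by zero outside [I]: the sum has at most one term. *)
pose z : 'cV[rat]_q := \col_i \sum_(l | h l == i) v 0 l.
have zh l : z (h l) 0 = v 0 l.
  by rewrite mxE (eq_bigl (pred1 l)) ?big_pred1_eq // => j; rewrite /= inj_eq.
exists z; [|split].
- apply: contraNneq v_neq0 => z0; apply/eqP/rowP=> l.
  by rewrite -zh z0 !mxE.
- move=> i xi; rewrite mxE big1 // => l /eqP hl.
  by have := enum_valP l; rewrite -/(h l) hl inE xi.
move=> j Tj; have jT : j \in T by rewrite inE.
transitivity ((v *m B^T) 0 (enum_rank_in jT j)); last by rewrite vB mxE.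
rewrite [LHS]mxE mxE (bigID (mem I)) /= [X in _ + X]big1 ?addr0.
  rewrite big_enum_val; apply: eq_bigr => l _.
  by rewrite zh !mxE /k enum_rankK_in // mulrC.
move=> i; rewrite inE negbK => xi; rewrite [z i 0]mxE big1 ?mulr0 // => l /eqP hl.
by have := enum_valP l; rewrite -/(h l) hl inE xi.
Qed.

(** Equivalently, [y] lies between the floor and the ceiling of [x]; in terms
    of integer bounds the relation is visibly transitive. *)
Definition int_bounds_kept (x y : rat) : Prop :=
  forall m : int, (m%:~R <= x -> m%:~R <= y) /\ (x <= m%:~R -> y <= m%:~R).

Lemma int_bounds_kept_trans y x z :
  int_bounds_kept x y -> int_bounds_kept y z -> int_bounds_kept x z.
Proof. by move=> xy yz m; case: (xy m) (yz m) => ? ? []; split; auto. Qed.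

Lemma int_bounds_kept_int x y :
  x \is a Num.int -> int_bounds_kept x y -> y = x.
Proof.
move=> /intrP[m ->] /(_ m)[lb ub].
by apply/eqP; rewrite eq_le ub ?lb.
Qed.

Lemma int_bounds_kept_floor x y :
    (Num.floor x)%:~R <= y -> y <= (Num.floor x + 1)%:~R ->
    (x \is a Num.int -> y = x) -> int_bounds_kept x y.
Proof.
move=> xy yx int_y; have [/int_y-> //|x_frac] := boolP (x \is a Num.int).
move=> m; split=> [mx|xm].
  by apply: le_trans xy; rewrite ler_int floor_ge_int.
apply: le_trans yx _; rewrite ler_int lezD1 floor_lt_int.
by rewrite lt_neqAle xm andbT; apply: contraNneq x_frac => ->; rewrite intr_int.
Qed.

(** Induction on the number of fractional entries of [x] and [A x].  The
    direction of [fractional_direction] may be negated, so that it can be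
    chosen not to decrease the functional [w]. *)
Lemma tu_rounding p q (A : 'M[int]_(p, q)) (w : 'I_q -> rat) (x : 'cV[rat]_q)
    (AQ := map_mx intr A : 'M[rat]_(p, q)) :
    totally_unimodular A ->
  exists y : 'cV[int]_q, let yQ := map_mx intr y : 'cV[rat]_q in
    [/\ forall i, int_bounds_kept (x i 0) (yQ i 0),
        forall j, int_bounds_kept ((AQ *m x) j 0) ((AQ *m yQ) j 0)
      & \sum_i w i * x i 0 <= \sum_i w i * yQ i 0].
Proof.
move=> tuA.
pose val (x : 'cV[rat]_q) (s : 'I_q + 'I_p) : rat :=
  match s with inl i => x i 0 | inr j => (AQ *m x) j 0 end.
have valD e u v s : val (u + e *: v) s = val u s + e * val v s.
  by case: s => i /=; rewrite -?scalemxAr ?mulmxDr -?scalemxAr !mxE.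
suff: exists y : 'cV[int]_q, let yQ := map_mx intr y : 'cV[rat]_q in
    (forall s, int_bounds_kept (val x s) (val yQ s)) /\
    \sum_i w i * x i 0 <= \sum_i w i * yQ i 0.
  by case=> y [xy wxy]; exists y; split=> // [i|j]; [apply: (xy (inl i)) | apply: (xy (inr j))].
have [N] := ubnP #|[set s | val x s \isn't a Num.int]|.
elim: N x => // N IH x; rewrite ltnS => leN.
have [/existsP frac|] := boolP [exists i, x i 0 \isn't a Num.int]; last first.
  rewrite negb_exists => /forallP int_x.
  exists (\col_i Num.floor (x i 0)).
  have -> : map_mx intr (\col_i Num.floor (x i 0)) = x.
    apply/matrixP=> i j; rewrite !mxE (ord1 j) floorK //.
    by have := int_x i; rewrite negbK.
  by split=> // s m.
have [z0 z0_neq0 [int_z0 int_Az0]] := fractional_direction tuA frac.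
have [z z_neq0 [int_z wz]] : exists2 z : 'cV[rat]_q, z != 0 &
    (forall s, val x s \is a Num.int -> val z s = 0) /\ 0 <= \sum_i w i * z i 0.
  have [wz|wz] := leP 0 (\sum_i w i * z0 i 0).
    by exists z0 => //; split=> // -[i|j] /=; [apply: int_z0 | apply: int_Az0].
  exists (- z0); rewrite ?oppr_eq0 //; split=> [[i|j] /= xs|].
  - by rewrite mxE int_z0 ?oppr0.
  - by rewrite mulmxN mxE int_Az0 ?oppr0.
  rewrite -oppr_le0 -sumrN (eq_bigr (fun i => w i * z0 i 0)) ?ltW // => i _.
  by rewrite mxE mulrN opprK.
(* Each entry moves inside the interval from its floor to its floor plus one;
   the boolean tells the distance to the upper end from the one to the lower. *)
pose a (t : bool * ('I_q + 'I_p)) := if t.1 then val z t.2 else - val z t.2.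
pose b (t : bool * ('I_q + 'I_p)) :=
  let fl := Num.floor (val x t.2) in
  if t.1 then (fl + 1)%:~R - val x t.2 else val x t.2 - fl%:~R.
have [|||e e_gt0 [step [t b_gt0 t_max]]] := @max_step _ _ a b.
- case=> -[] s; rewrite /b /= subr_ge0 ?floor_le //.
  by rewrite ltW // floorD1_gt.
- case=> -[] s; rewrite /a /b /= subr_gt0.
    by rewrite floorD1_gt.
  move=> z_s; rewrite lt_neqAle floor_le andbT -intrEfloor.
  by apply/negP=> /int_z zs0; rewrite zs0 oppr0 ltxx in z_s.
- have [i zi] : exists i, z i 0 != 0.
    apply/existsP; apply: contraNT z_neq0; rewrite negb_exists => /forallP z0E.
    by apply/eqP/colP=> i; rewrite mxE; apply/eqP; rewrite -[_ == _]negbK z0E.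
  have [z_gt0|z_lt0|z0E] := ltrgt0P (z i 0); last by rewrite z0E eqxx in zi.
    by exists (true, inl i).
  by exists (false, inl i); rewrite /a /= oppr_gt0.
pose x' := x + e *: z.
have x'_kept s : int_bounds_kept (val x s) (val x' s).
  apply: int_bounds_kept_floor.
  - by have := step (false, s); rewrite /a /b /= valD; lra.
  - by have := step (true, s); rewrite /a /b /= valD; lra.
  by move=> /int_z zs; rewrite valD zs mulr0 addr0.
have [|y [x'y wx'y]] := IH x'.
  apply: leq_trans leN; apply: proper_card; apply/properP; split.
    apply/subsetP=> s; rewrite !inE; apply: contra => int_s.
    by rewrite (int_bounds_kept_int int_s (x'_kept s)).
  exists t.2; rewrite !inE.
    apply/negP=> /int_z zt; case: t t_max b_gt0 zt => -[] s; rewrite /a /b /= => <- + zs.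
      by rewrite zs mul0r ltxx.
    by rewrite zs oppr0 mul0r ltxx.
  rewrite negbK valD; case: t t_max {b_gt0} => -[] s; rewrite /a /b /= => ts.
    have -> : val x s + e * val z s = (Num.floor (val x s) + 1)%:~R by lra.
    exact: intr_int.
  have -> : val x s + e * val z s = (Num.floor (val x s))%:~R by lra.
  exact: intr_int.
exists y; split=> [s|].
  exact: int_bounds_kept_trans (x'_kept s) (x'y s).
apply: le_trans wx'y; rewrite -subr_ge0 -sumrB.
rewrite (eq_bigr (fun i => e * (w i * z i 0))); last by move=> i _; rewrite !mxE; ring.
by rewrite -mulr_sumr mulr_ge0 ?(ltW e_gt0).
Qed.

(** * Splitting covers of a unimodular complex *)

Definition splits_covers n (D : simplicial_complex n) : Prop :=
  forall k (c : 'X_{1..n}), kcover D k.+1 c ->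
    exists a b : 'X_{1..n}, [/\ kcover D 1 a, kcover D k b & c = (a + b)%MM].

Lemma sum_over_facet n (D : simplicial_complex n) (x : 'cV[rat]_n) j :
  (map_mx intr (incidence_matrix D)^T *m x) j 0 =
    \sum_(i in (enum_val j : {set 'I_n})) x i 0.
Proof.
rewrite mxE [RHS]big_mkcond; apply: eq_bigr => i _.
by rewrite !mxE; case: ifP; rewrite ?mul1r ?mul0r.
Qed.

(** A facet of [c]-weight S >= k+1 has weight S/(k+1) in x = c/(k+1), and
    1 <= S/(k+1) <= S - k.  Rounding x keeps both integer bounds: the lower one
    says that the rounded vector is a 1-cover, the upper one that what remains
    of [c] is a [k]-cover. *)
Lemma unimodular_splits_covers n (D : simplicial_complex n) :
  unimodular D -> splits_covers D.
Proof.
move=> uD k c cov_c.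
have tuD := totally_unimodular_tr (unimodular_total uD).
pose x : 'cV[rat]_n := \col_i ((c i)%:R / k.+1%:R).
have [y [xy Axy _]] := tu_rounding (fun=> 0) x tuD.
have k1_gt0 : 0 < k.+1%:R :> rat by rewrite ltr0n.
have y_ge0 i : 0 <= y i 0.
  have [+ _] := xy i 0; rewrite !mxE ler_int; apply.
  by rewrite divr_ge0 ?ler0n.
have y_le i : y i 0 <= (c i)%:Z.
  have [_] := xy i (c i)%:Z; rewrite !mxE ler_int; apply.
  by rewrite ler_pdivrMr // ler_peMr ?ler0n // ler1n.
pose a : 'X_{1..n} := [multinom `|y i 0%R|%N | i < n].
have aE i : (a i)%:Z = y i 0 by rewrite mnmE gez0_abs.
have le_ac i : (a i <= c i)%N by rewrite -lez_nat aE.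
have facet_bounds F : F \in facets D ->
    (1 <= \sum_(i in F) a i)%N /\ (k + \sum_(i in F) a i <= \sum_(i in F) c i)%N.
  move=> FD; pose S := (\sum_(i in F) c i)%N.
  have leS : (k.+1 <= S)%N by apply: cov_c.
  have FE : enum_val (enum_rank_in FD F) = F by rewrite enum_rankK_in.
  have xS : \sum_(i in F) x i 0 = S%:R / k.+1%:R.
    by rewrite natr_sum mulr_suml; apply: eq_bigr => i _; rewrite mxE.
  have yS : \sum_(i in F) (map_mx intr y : 'cV[rat]_n) i 0 = (\sum_(i in F) a i)%N%:~R.
    by rewrite -pmulrn natr_sum; apply: eq_bigr => i _; rewrite mxE -aE -pmulrn.
  have [] := (Axy (enum_rank_in FD F) 1, Axy (enum_rank_in FD F) (S - k)%N%:Z).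
  rewrite !sum_over_facet FE xS yS !ler_int !lez_nat => -[lb _] [_ ub]; split.
    by apply: lb; rewrite ler_pdivlMr // mul1r ler_nat.
  rewrite addnC -[leqRHS](subnK (ltnW leS)) leq_add2r; apply: ub.
  by rewrite ler_pdivrMr // -pmulrn -natrM ler_nat -/S; nia.
exists a, (c - a)%MM; split.
- by move=> F /facet_bounds[].
- move=> F /facet_bounds[_ ub].
  rewrite (eq_bigr (fun i => c i - a i)%N); last by move=> i _; rewrite mnmBE.
  by rewrite sumnB // leq_subRL ?leq_sum // addnC.
by apply/mnmP=> i; rewrite mnmDE mnmBE subnKC.
Qed.

(** * Fractional packing of facets *)

(** A [k]-cover is a sum of [k] 1-covers, and the support of a 1-cover is a
    vertex cover. *)
Lemma weight_kcover n (D : simplicial_complex n) (w : 'I_n -> rat) (kappa : rat)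
    k (z : 'X_{1..n}) :
    splits_covers D -> (forall i, 0 <= w i) ->
    (forall C, vertex_cover D C -> kappa <= \sum_(i in C) w i) ->
  kcover D k z -> k%:R * kappa <= \sum_i w i * (z i)%:R.
Proof.
move=> splitD w_ge0 w_cov; elim: k z => [|k IH] z cov_z.
  by rewrite mul0r sumr_ge0 // => i _; rewrite mulr_ge0 ?ler0n.
have [a [b [cov_a /IH cov_b ->]]] := splitD _ _ cov_z.
rewrite (eq_bigr (fun i => w i * (a i)%:R + w i * (b i)%:R)); last first.
  by move=> i _; rewrite mnmDE natrD mulrDr.
rewrite big_split -natr1 mulrDl addrC mul1r lerD //=.
have supp_cov : vertex_cover D [set i | 0 < a i]%N.
  apply/forall_inP=> F FD; apply/set0Pn; have := cov_a F FD.
  rewrite lt0n sum_nat_eq0 negb_forall => /existsP[i].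
  by rewrite negb_imply -lt0n => /andP[iF ai]; exists i; rewrite !inE ai.
apply: le_trans (w_cov _ supp_cov) _; rewrite big_mkcond ler_sum // => i _.
rewrite inE; case: ifP => ai; last by rewrite mulr_ge0 ?ler0n.
by rewrite ler_peMr // ler1n.
Qed.

(** Let T be the set of the vertex covers of weight [kappa] and z the sum of
    their indicators, a #|T|-cover of weight #|T| kappa.  A facet F in the
    support of [w] meets each member of T, so it has the required property as
    soon as z(F) <= #|T|.  If z(F) > #|T| for all such F, lower z by one at a
    point of positive weight and raise it at the points of weight zero, which
    takes care of the other facets at no cost: the result is a #|T|-cover of
    weight less than #|T| kappa, against [weight_kcover]. *)
Lemma tight_facet n (D : simplicial_complex n) (w : 'I_n -> rat) (kappa : rat) :
    splits_covers D -> 0 < kappa -> (forall i, 0 <= w i) ->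
    (forall C, vertex_cover D C -> kappa <= \sum_(i in C) w i) ->
  exists F : {set 'I_n}, [/\ F \in facets D, forall i, i \in F -> 0 < w i &
    forall C, vertex_cover D C -> \sum_(i in C) w i = kappa -> #|C :&: F| = 1%N].
Proof.
move=> splitD kappa_gt0 w_ge0 w_cov.
pose T := [set C : {set 'I_n} | vertex_cover D C && (\sum_(i in C) w i == kappa)].
pose z i := (\sum_(C in T) (i \in (C : {set 'I_n})))%N.
have zF (F : {set 'I_n}) : (\sum_(i in F) z i = \sum_(C in T) #|C :&: F|)%N.
  rewrite exchange_big; apply: eq_bigr => C _ /=.
  by rewrite -big_mkcondr /= sum1_card; apply: eq_card => i; rewrite !inE andbC.
suff /exists_inP[F FD /andP[/forall_inP F_supp tight_F]] : [exists F : {set 'I_n} in facets D,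
    [forall i in F, 0 < w i] && (\sum_(i in F) z i <= #|T|)%N].
  exists F; split=> // C covC tightC.
  have CT : C \in T by rewrite inE covC tightC eqxx.
  have meetF (B : {set 'I_n}) : B \in T -> (1 <= #|B :&: F|)%N.
    by rewrite inE card_gt0 => /andP[/forall_inP/(_ F FD)].
  move: tight_F; rewrite zF -sum1_card (bigD1 C) //= [leqRHS](bigD1 C) //= => le_rest.
  apply/eqP; rewrite eqn_leq meetF // andbT.
  rewrite -(leq_add2r (\sum_(B in T | B != C) 1)); apply: leq_trans le_rest.
  by rewrite leq_add2l leq_sum // => B /andP[/meetF].
apply: contraT; rewrite negb_exists => /forallP no_F.
have {}no_F (F : {set 'I_n}) : F \in facets D -> (forall i, i \in F -> 0 < w i) ->
    (#|T| < \sum_(i in F) z i)%N.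
  move=> FD F_supp; have := no_F F.
  by rewrite FD /= negb_and -ltnNge => /orP[/negP[]|//]; apply/forall_inP.
have null_meet (F : {set 'I_n}) : F \in facets D -> (exists2 i, i \in F & w i = 0) \/ (#|T| < \sum_(i in F) z i)%N.
  move=> FD; have [/exists_inP[i iF /eqP wi]|] := boolP [exists i in F, w i == 0].
    by left; exists i.
  rewrite negb_exists_in => /forall_inP F_supp; right; apply: no_F => // i iF.
  by rewrite lt_def F_supp ?w_ge0.
(* If there is no tight cover, [no_F] says that every facet meets the zero set
   of [w], which is then a vertex cover of weight 0. *)
have /existsP[C0 C0T] : [exists C, C \in T].
  apply: contraTT kappa_gt0; rewrite negb_exists -leNgt => /forallP T0.
  apply: le_trans (w_cov [set i | w i == 0] _) _.
    apply/forall_inP=> F FD; apply/set0Pn.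
    case: (null_meet F FD) => [[i iF wi]|]; first by exists i; rewrite !inE wi eqxx.
    rewrite zF big1 ?ltn0 // => C; by rewrite (negbTE (T0 C)).
  by rewrite big1 // => i; rewrite inE => /eqP.
have C0E : \sum_(i in C0) w i = kappa by move: C0T; rewrite inE => /andP[_ /eqP].
have [i0 i0C w_i0] : exists2 i0, i0 \in C0 & 0 < w i0.
  apply/exists_inP; apply: contraLR kappa_gt0; rewrite negb_exists_in => /forall_inP w0.
  by rewrite -leNgt -C0E sumr_le0 // => i /w0; rewrite -leNgt.
have z_i0 : (0 < z i0)%N by rewrite /z (bigD1 C0) //= i0C.
pose z' : 'X_{1..n} :=
  [multinom ((z i - (i == i0)) + #|T| * (w i == 0%R))%N | i < n].
have cov_z' : kcover D #|T| z'.
  move=> F FD; case: (null_meet F FD) => [[i iF wi]|].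
    by rewrite (bigD1 i) //= mnmE wi eqxx muln1 -addnA addnCA leq_addr.
  move=> ltF; rewrite -ltnS; apply: leq_trans ltF _.
  have : (\sum_(i in F) z i <= \sum_(i in F) (z' i + (i == i0)))%N.
    apply: leq_sum => i _; rewrite mnmE addnAC.
    by apply: leq_trans (leq_addr _ _); rewrite addnC -leq_subLR.
  rewrite big_split /= => /leq_trans; apply; rewrite -addn1 leq_add2l.
  rewrite -big_mkcondr /= sum1_card -(card1 i0); apply: subset_leq_card.
  by apply/subsetP=> i; rewrite !inE => /andP[].
have := weight_kcover splitD w_ge0 w_cov cov_z'; rewrite leNgt => /negP[].
have -> : #|T|%:R * kappa = \sum_i w i * (z i)%:R.
  transitivity (\sum_(C in T) \sum_(i in (C : {set 'I_n})) w i).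
    rewrite -sum1_card natr_sum mulr_suml; apply: eq_bigr => C.
    by rewrite inE => /andP[_ /eqP->]; rewrite mul1r.
  under [RHS]eq_bigr => i _ do rewrite natr_sum mulr_sumr.
  rewrite exchange_big; apply: eq_bigr => C _ /=; rewrite big_mkcond.
  by apply: eq_bigr => i _; case: ifP; rewrite ?mulr1 ?mulr0.
rewrite (bigD1 i0) // [ltRHS](bigD1 i0) //=; apply: ltr_leD.
  by rewrite mnmE eqxx gt_eqF // muln0 addn0 ltr_pM2l // ltr_nat; lia.
apply: ler_sum => i /negbTE i_i0; rewrite mnmE i_i0 subn0.
have [->|_] := eqVneq (w i) 0; first by rewrite !mul0r.
by rewrite muln0 addn0.
Qed.

(** The fractional half of the max-flow min-cut property of D, by the greedy
    method.  Subtracting from [w] a multiple e of the indicator of a facet F,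
    and e from [kappa], changes the slack of the vertex cover C by
    e (#|C :&: F| - 1).  With F from [tight_facet], slacks that are zero stay
    zero, and for the largest possible e another one vanishes. *)
Lemma fractional_packing n (D : simplicial_complex n) (w : 'I_n -> rat)
    (kappa : rat) :
    splits_covers D -> 0 <= kappa -> (forall i, 0 <= w i) ->
    (forall C, vertex_cover D C -> kappa <= \sum_(i in C) w i) ->
  exists y : {set 'I_n} -> rat,
    [/\ forall F, 0 <= y F,
        forall i, \sum_(F in facets D | i \in F) y F <= w i
      & \sum_(F in facets D) y F = kappa].
Proof.
move=> splitD.
pose slack (w : 'I_n -> rat) (kappa : rat) (t : option ('I_n + {set 'I_n})) : rat :=
  match t with
  | None => kappa
  | Some (inl i) => w i
  | Some (inr C) => if vertex_cover D C then \sum_(i in C) w i - kappa else 0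
  end.
have [N] := ubnP #|[set t | 0 < slack w kappa t]|.
elim: N w kappa => // N IH w kappa; rewrite ltnS => leN kappa_ge0 w_ge0 w_cov.
have [kappa0|kappa_gt0] := leP kappa 0.
  have {kappa0} kappa0 : kappa = 0 by apply/le_anti/andP.
  exists (fun=> 0); split=> // [i|]; first by rewrite big1_idem ?addr0.
  by rewrite big1.
have [F [FD F_supp tight_F]] := tight_facet splitD kappa_gt0 w_ge0 w_cov.
pose a (t : option ('I_n + {set 'I_n})) : rat :=
  match t with
  | None => 1
  | Some (inl i) => (i \in F)%:R
  | Some (inr C) => if vertex_cover D C then #|C :&: F|%:R - 1 else 0
  end.
have a_ge0 t : 0 <= a t.
  case: t => [[i|C]|] //=.
  case: ifP => // /forall_inP/(_ F FD); rewrite -card_gt0 => meetF.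
  by rewrite subr_ge0 ler1n.
have slack_ge0 t : 0 <= slack w kappa t.
  by case: t => [[i|C]|] //=; case: ifP => // /w_cov; rewrite subr_ge0.
have [|||e e_gt0 [step [t t_gt0 t_max]]] := @max_step _ _ a (slack w kappa).
- exact: slack_ge0.
- move=> t a_gt0; rewrite lt_def slack_ge0 andbT; apply/negP=> /eqP.
  case: t a_gt0 => [[i|C]|] /=; last by move=> _ kappa0; rewrite kappa0 ltxx in kappa_gt0.
    case: (boolP (i \in F)) => [/F_supp + _ wi|_]; last by rewrite ltxx.
    by rewrite wi ltxx.
  case: ifP => [covC|_]; last by rewrite ltxx.
  move=> /[swap] /subr0_eq /(tight_F _ covC) ->.
  by rewrite subrr ltxx.
- by exists None.
pose w' i := w i - e * (i \in F)%:R; pose kappa' := kappa - e.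
have slack' u : slack w' kappa' u = slack w kappa u - e * a u.
  case: u => [[i|C]|] //=; last by rewrite mulr1.
  case: ifP => _; last by rewrite mulr0 subr0.
  rewrite sumrB -mulr_sumr.
  have -> : \sum_(i in C) (i \in F)%:R = #|C :&: F|%:R :> rat.
    by rewrite -natr_sum -big_mkcondr /= sum1_card; congr _%:R; apply: eq_card => i; rewrite !inE.
  by rewrite /kappa'; ring.
have slack'_ge0 u : 0 <= slack w' kappa' u by rewrite slack' mulrC subr_ge0.
have [||i|C covC|y [y_ge0 y_w y_kappa]] := IH w' kappa'.
- apply: leq_trans leN; apply: proper_card; apply/properP; split.
    apply/subsetP=> u; rewrite !inE => /lt_le_trans; apply.
    by rewrite slack' lerBlDr lerDl mulr_ge0 ?(ltW e_gt0).
  by exists t; rewrite !inE // slack' mulrC t_max subrr ltxx.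
- exact: (slack'_ge0 None).
- exact: (slack'_ge0 (Some (inl i))).
- by have := slack'_ge0 (Some (inr C)); rewrite /= covC subr_ge0.
exists (fun G => y G + e * (G == F)%:R); split=> [G|i|].
- by rewrite addr_ge0 // mulr_ge0 ?ler0n // ltW.
- rewrite big_split /= -mulr_sumr.
  have -> : \sum_(G in facets D | i \in G) (G == F)%:R = (i \in F)%:R :> rat.
    have [iF|iF] := boolP (i \in F).
      rewrite (bigD1 F) ?FD //= eqxx big1 ?addr0 // => G.
      by case/andP=> _ /negbTE->.
    rewrite big1 // => G /andP[_ iG]; case: eqP => // GF.
    by rewrite -GF iG in iF.
  by have := y_w i; rewrite /w'; lra.
rewrite big_split /= y_kappa (bigD1 F) //= eqxx big1 ?addr0 ?mulr1 /kappa'; last first.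
  by move=> G /andP[_ /negbTE->]; rewrite mulr0.
by rewrite subrK.
Qed.

(** * Splitting covers of the dual complex *)

(** Vertex covers of D contain facets of the dual complex, so [c] gives them
    weight at least [k].  Rounding a fractional packing keeps the bounds
    [c i], which are integers, and does not decrease the total. *)
Lemma integral_packing n (D : simplicial_complex n) k (c : 'X_{1..n}) :
    unimodular D -> kcover (dual_complex D) k c ->
  exists y : 'I_#|facets D| -> nat,
    (forall i, \sum_(j | i \in (enum_val j : {set 'I_n})) y j <= c i)%N /\
    (k <= \sum_j y j)%N.
Proof.
move=> uD cov_c.
have [||C covC|y [y_ge0 y_c y_k]] := fractional_packing (w := fun i => (c i)%:R)
  (kappa := k%:R) (unimodular_splits_covers uD).
- exact: ler0n.
- by move=> i; apply: ler0n.
- have [C' minC' sC'C] := minset_exists covC.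
  rewrite -natr_sum ler_nat; apply: leq_trans (cov_c C' _) _.
    by rewrite facets_dual inE.
  rewrite [leqRHS](big_setID C') /= (setIidPr sC'C); exact: leq_addr.
pose x : 'cV[rat]_#|facets D| := \col_j y (enum_val j).
have [z [xz Axz le_xz]] := tu_rounding (fun=> 1) x (unimodular_total uD).
have z_ge0 j : 0 <= z j 0.
  by have [+ _] := xz j 0; rewrite !mxE ler_int; apply; apply: y_ge0.
exists (fun j => `|z j 0%R|%N); split=> [i|].
  have [_] := Axz i (c i)%:Z; rewrite !mxE.
  have -> : \sum_j map_mx intr (incidence_matrix D) i j * x j 0 =
      \sum_(F in facets D | i \in F) y F :> rat.
    rewrite [RHS]big_mkcondr [RHS]big_enum_val; apply: eq_bigr => j _.
    by rewrite !mxE; case: ifP; rewrite ?mul1r ?mul0r.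
  have -> : \sum_j map_mx intr (incidence_matrix D) i j * map_mx intr z j 0 =
      (\sum_(j | i \in (enum_val j : {set 'I_n})) `|z j 0%R|)%N%:~R :> rat.
    rewrite -pmulrn natr_sum [RHS]big_mkcond; apply: eq_bigr => j _.
    rewrite !mxE; case: ifP; rewrite ?mul0r // mul1r.
    by rewrite pmulrn gez0_abs.
  by rewrite ler_int lez_nat; apply; apply: y_c.
rewrite -(ler_nat rat) natr_sum -y_k big_enum_val.
have : \sum_(j < #|facets D|) 1 * x j 0 = \sum_(j < #|facets D|) y (enum_val j).
  by apply: eq_bigr => j _; rewrite mxE mul1r.
move=> <-; apply: le_trans le_xz _; apply: ler_sum => j _.
by rewrite mul1r mxE pmulrn gez0_abs.
Qed.

(** Remove from [c] one facet F of an integral packing: F meets all vertex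
    covers, and so do the k or more facets that remain packed in the
    difference. *)
Lemma unimodular_dual_splits_covers n (D : simplicial_complex n) :
  unimodular D -> splits_covers (dual_complex D).
Proof.
move=> uD k c /(integral_packing uD)[y [y_c y_k]].
have [j y_j] : exists j, (0 < y j)%N.
  apply/existsP; apply: contraLR y_k; rewrite negb_exists -ltnNge => /forallP y0.
  by rewrite big1 // => j _; apply/eqP; rewrite -leqn0 leqNgt y0.
pose F : {set 'I_n} := enum_val j.
have FD : F \in facets D by apply: enum_valP.
pose a : 'X_{1..n} := [multinom (i \in F : nat) | i < n].
pose y' l := (y l - (l == j))%N.
have y'_a i : (\sum_(l | i \in (enum_val l : {set 'I_n})) y' l + a i <= c i)%N.
  apply: leq_trans (y_c i); rewrite mnmE.
  have [iF|_] := boolP (i \in F); last first.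
    by rewrite addn0; apply: leq_sum => l _; apply: leq_subr.
  rewrite (bigD1 j) //= [leqRHS](bigD1 j) //= addnAC /y' eqxx subnK //.
  by rewrite leq_add2l; apply: leq_sum => l _; apply: leq_subr.
have meet_cover (C G : {set 'I_n}) : C \in facets (dual_complex D) -> G \in facets D ->
    (1 <= \sum_(i in C) (i \in G))%N.
  rewrite facets_dual inE => /minsetP[/forall_inP covC _] /covC.
  rewrite -card_gt0 -big_mkcondr /= sum1_card.
  by congr (0 < _)%N; apply: eq_card => i; rewrite !inE.
exists a, (c - a)%MM; split.
- move=> C CD; apply: leq_trans (meet_cover C F CD FD) _.
  by apply: leq_sum => i _; rewrite mnmE.
- move=> C CD.
  have le_y' : (k <= \sum_l y' l)%N.
    rewrite -ltnS; apply: leq_trans y_k _; rewrite (bigD1 j) //= [in leqRHS](bigD1 j) //=.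
    rewrite -addSn; apply: leq_add; first by rewrite /y' eqxx; lia.
    by apply: leq_sum => l /negbTE lj; rewrite /y' lj subn0.
  apply: leq_trans le_y' _.
  apply: (@leq_trans (\sum_(i in C) \sum_(l | i \in (enum_val l : {set 'I_n})) y' l)); last first.
    by apply: leq_sum => i _; rewrite mnmBE; have := y'_a i; lia.
  rewrite [leqRHS](eq_bigr (fun i => \sum_l (i \in (enum_val l : {set 'I_n})) * y' l)%N); last first.
    by move=> i _; rewrite big_mkcond; apply: eq_bigr => l _; case: ifP; rewrite ?mul1n ?mul0n.
  rewrite exchange_big /=; apply: leq_sum => l _; rewrite -big_distrl /=.
  by rewrite leq_pmull // meet_cover // enum_valP.
apply/mnmP=> i; rewrite mnmDE mnmBE subnKC //.
by apply: leq_trans (y'_a i); rewrite leq_addl.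
Qed.

(** * From splitting covers to standard grading *)

Section CoverAlgebra.
Variables (K : fieldType) (n : nat) (D : simplicial_complex n).
Local Notation component := (@cover_component K n D).
Local Notation algebra := (@vertex_cover_algebra K n D).

Lemma kcoverD k l (c d : 'X_{1..n}) :
  kcover D k c -> kcover D l d -> kcover D (k + l) (c + d)%MM.
Proof.
move=> cov_c cov_d F FD; under eq_bigr do rewrite mnmDE.
by rewrite big_split leq_add ?cov_c ?cov_d.
Qed.

Lemma component0 k : component k 0.
Proof. by exists [::]; rewrite ?big_nil. Qed.

Lemma componentD k f g : component k f -> component k g -> component k (f + g).
Proof.
move=> [s cov_s ->] [t cov_t ->]; exists (s ++ t); last by rewrite big_cat.
by move=> p; rewrite mem_cat => /orP[/cov_s|/cov_t].
Qed.

Lemma component_term k (a : K) (c : 'X_{1..n}) :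
  kcover D k c -> component k ((a *: 'X_[c]) *: 'X^k).
Proof.
move=> cov_c; exists [:: (a, c)]; last by rewrite big_seq1.
by move=> p; rewrite inE => /eqP->.
Qed.

Lemma algebra_component k f : component k f -> algebra f.
Proof.
move=> fk; exists k.+1, (fun l => if l == k then f else 0); split=> [l|].
  by case: eqP => [->|_] //; apply: component0.
rewrite big_ord_recr /= eqxx big1 ?add0r // => i _.
by rewrite ltn_eqF.
Qed.

Lemma algebraD f g : algebra f -> algebra g -> algebra (f + g).
Proof.
move=> [N1 [f1 [f1k ->]]] [N2 [f2 [f2k ->]]].
exists (N1 + N2)%N, (fun k => (if (k < N1)%N then f1 k else 0) + (if (k < N2)%N then f2 k else 0)).
split=> [k|].
  by apply: componentD; case: ifP => // _; apply: component0.
rewrite big_split /= -!big_mkcond /=; congr (_ + _).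
  by rewrite [LHS](big_ord_widen _ _ (leq_addr N2 N1)).
by rewrite [LHS](big_ord_widen _ _ (leq_addl N1 N2)).
Qed.

Lemma algebra_sum (I : eqType) (s : seq I) (F : I -> {poly {mpoly K[n]}}) :
  (forall i, i \in s -> algebra (F i)) -> algebra (\sum_(i <- s) F i).
Proof.
move=> F_alg; rewrite big_seq; apply: (big_ind algebra) => //.
  exact: algebra_component (component0 0).
exact: algebraD.
Qed.

Lemma algebra_ind (P : {poly {mpoly K[n]}} -> Prop) :
    P 0 -> (forall f g, P f -> P g -> P (f + g)) ->
    (forall k a c, kcover D k c -> P ((a *: 'X_[c]) *: 'X^k)) ->
  forall f, algebra f -> P f.
Proof.
move=> P0 PD Pterm f [N [g [gk ->]]]; apply: (big_ind P) => // i _.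
have [s cov_s ->] := gk i; rewrite big_seq; apply: (big_ind P) => // p /cov_s.
exact: Pterm.
Qed.

Lemma algebraM f g : algebra f -> algebra g -> algebra (f * g).
Proof.
move=> f_alg g_alg; elim/algebra_ind: f / f_alg => [|f1 f2 ? ?|k a c cov_c].
- by rewrite mul0r; apply: algebra_component (component0 0).
- by rewrite mulrDl; apply: algebraD.
elim/algebra_ind: g / g_alg => [|g1 g2 ? ?|l b d cov_d].
- by rewrite mulr0; apply: algebra_component (component0 0).
- by rewrite mulrDr; apply: algebraD.
rewrite -scalerAl -scalerAr scalerA -scalerAl -scalerAr scalerA -mpolyXD -exprD.
exact: algebra_component (component_term _ (kcoverD _ _)).
Qed.

Lemma algebra_scalar (a : {mpoly K[n]}) : algebra a%:A.
Proof.
rewrite [a]mpolyE scaler_suml; apply: algebra_sum => c _.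
by apply: (@algebra_component 0); apply: component_term => F _.
Qed.

Lemma splits_covers_standard : splits_covers D -> standard_graded K D.
Proof.
move=> splitD f; split=> [|gen_f]; last first.
  elim: gen_f => {f} [a|f|f g _ + _|f g _ + _].
  - exact: algebra_scalar.
  - exact: algebra_component.
  - exact: algebraD.
  - exact: algebraM.
elim/algebra_ind=> {f} [|f g|k a c].
- by rewrite -(scale0r 1); apply: gen_scalar.
- exact: gen_add.
elim: k a c => [|k IH] a c; first by move=> _; apply: gen_scalar.
move=> /splitD[c1 [c2 [cov1 cov2 ->]]].
have -> : (a *: 'X_[(c1 + c2)%MM]) *: 'X^(k.+1) =
    ((1 *: 'X_[c1]) *: 'X^1) * ((a *: 'X_[c2]) *: 'X^k) :> {poly {mpoly K[n]}}.
  rewrite -scalerAl -scalerAr scalerA -scalerAl -scalerAr scalerA.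
  by rewrite mul1r -mpolyXD -exprD.
apply: gen_mul; last exact: IH.
exact/gen_mem/component_term.
Qed.

End CoverAlgebra.

Theorem corollary2p8 (K : fieldType) (n : nat) (Delta : simplicial_complex n)
    (hDelta : unimodular Delta) :
  standard_graded K Delta /\ standard_graded K (dual_complex Delta).
Proof.
by split; apply: splits_covers_standard;
  [apply: unimodular_splits_covers | apply: unimodular_dual_splits_covers].
Qed.
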